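(* Let $(\Omega,\mathscr{H},\widehat{\mathbb E})$ be a sub-linear expectation space and let $X_1,\ldots,X_n\in\mathscr{H}$ satisfy $\widehat{\mathbb E}[X_k]\le 0$ for $k=1,\ldots,n$. Suppose that $X_k$ is negatively dependent to $(X_{k+1},\ldots,X_n)$ for each $k=1,\ldots,n-1$. Put $S_k=X_1+\cdots+X_k$. Then $$\widehat{\mathbb E}\Big[\big(\max_{1\le k\le n}S_k\big)^2\Big]\le \sum_{k=1}^n\widehat{\mathbb E}[X_k^2].$$
   Context: Let $(\Omega,\mathcal F)$ be a measurable space. $C_{l,Lip}(\mathbb R^n)$ is the linear space of functions $\varphi:\mathbb R^n\to\mathbb R$ such that $|\varphi(x)-\varphi(y)|\le C(1+|x|^m+|y|^m)|x-y|$ for all $x,y\in\mathbb R^n$, for some $C>0$, $m\in\mathbb N$ depending on $\varphi$. $\mathscr H$ is a linear space of real functions on $(\Omega,\mathcal F)$ (called random variables) such that $X_1,\ldots,X_n\in\mathscr H$ implies $\varphi(X_1,\ldots,X_n)\in\mathscr H$ for every $\varphi\in C_{l,Lip}(\mathbb R^n)$. A sub-linear expectation on $\mathscr H$ is a functional $\widehat{\mathbb E}:\mathscr H\to[-\infty,\infty]$ such that for all $X,Y\in\mathscr H$: (a) $X\ge Y$ implies $\widehat{\mathbb E}[X]\ge\widehat{\mathbb E}[Y]$; (b) $\widehat{\mathbb E}[c]=c$ for constants $c$; (c) $\widehat{\mathbb E}[X+Y]\le\widehat{\mathbb E}[X]+\widehat{\mathbb E}[Y]$ whenever the right side is not of the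 form $+\infty-\infty$ or $-\infty+\infty$; (d) $\widehat{\mathbb E}[\lambda X]=\lambda\widehat{\mathbb E}[X]$ for $\lambda\ge0$. The triple $(\Omega,\mathscr H,\widehat{\mathbb E})$ is called a sub-linear expectation space. Negative dependence: a random vector $\mathbf Y=(Y_1,\ldots,Y_n)$, $Y_i\in\mathscr H$, is negatively dependent to $\mathbf X=(X_1,\ldots,X_m)$, $X_i\in\mathscr H$, if for each pair $\varphi_1\in C_{l,Lip}(\mathbb R^m)$, $\varphi_2\in C_{l,Lip}(\mathbb R^n)$ one has $\widehat{\mathbb E}[\varphi_1(\mathbf X)\varphi_2(\mathbf Y)]\le\widehat{\mathbb E}[\varphi_1(\mathbf X)]\,\widehat{\mathbb E}[\varphi_2(\mathbf Y)]$ whenever $\varphi_1(\mathbf X)\ge0$, $\widehat{\mathbb E}[\varphi_2(\mathbf Y)]\ge0$, $\widehat{\mathbb E}[|\varphi_1(\mathbf X)\varphi_2(\mathbf Y)|]<\infty$, $\widehat{\mathbb E}[|\varphi_1(\mathbf X)|]<\infty$, $\widehat{\mathbb E}[|\varphi_2(\mathbf Y)|]<\infty$, and either $\varphi_1,\varphi_2$ are both coordinatewise nondecreasing or both coordinatewise non-increasing. *)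

(* Defs.v *)
From HB Require Import structures.
From mathcomp Require Import all_boot all_order all_algebra.
From mathcomp Require Import all_classical all_reals all_analysis.

Set Implicit Arguments.
Unset Strict Implicit.
Unset Printing Implicit Defensive.

Import Order.TTheory GRing.Theory Num.Theory.
Import numFieldNormedType.Exports.

Local Open Scope classical_set_scope.
Local Open Scope ring_scope.

(* The Euclidean norm; the library norm on matrices is the sup norm. *)
Definition enorm (R : realType) (n : nat) (x : 'rV[R]_n) : R :=
  Num.sqrt (\sum_(i < n) x 0 i ^+ 2).

Definition ClLip (R : realType) (n : nat) : set ('rV[R]_n -> R) :=
  [set phi | exists2 C : R, 0 < C & exists m : nat,
     forall x y : 'rV[R]_n,
       `|phi x - phi y| <= C * (1 + enorm x ^+ m + enorm y ^+ m) * enorm (x - y)].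

Definition coord_nondecreasing (R : realType) (n : nat) (phi : 'rV[R]_n -> R) :=
  forall x y : 'rV[R]_n, (forall i, x 0 i <= y 0 i) -> phi x <= phi y.

Definition coord_nonincreasing (R : realType) (n : nat) (phi : 'rV[R]_n -> R) :=
  forall x y : 'rV[R]_n, (forall i, x 0 i <= y 0 i) -> phi y <= phi x.

Definition at_vector (R : realType) (T : Type) (n : nat)
    (phi : 'rV[R]_n -> R) (X : 'I_n -> T -> R) : T -> R :=
  fun w => phi (\row_i X i w).

Record is_rv_space (R : realType) (T : Type) (H : set (T -> R)) : Prop := {
  rv_space_linear : GRing.submod_closed (mem H : {pred (T -> R^o)}) ;
  rv_space_comp : forall (n : nat) (phi : 'rV[R]_n -> R) (X : 'I_n -> T -> R),
    phi \in @ClLip R n -> (forall i, X i \in H) -> at_vector phi X \in H }.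

(* A functional on H is encoded as a total function whose values outside H are
   unconstrained. In the homogeneity clause 0 * +oo = 0 * -oo = 0. *)
Record is_sublinear_expectation (R : realType) (T : Type) (H : set (T -> R))
    (E : (T -> R) -> \bar R) : Prop := {
  sublin_mono : forall X Y : T -> R, X \in H -> Y \in H ->
    (forall w, Y w <= X w) -> (E Y <= E X)%E ;
  sublin_cst : forall c : R, E (cst c) = c%:E ;
  sublin_subadd : forall X Y : T -> R, X \in H -> Y \in H ->
    (E X +? E Y)%E -> (E (X \+ Y)%R <= E X + E Y)%E ;
  sublin_homo : forall (l : R) (X : T -> R), X \in H -> 0 <= l ->
    E (fun w => l * X w) = (l%:E * E X)%E }.

Definition neg_dependent (R : realType) (T : Type) (E : (T -> R) -> \bar R)
    (n m : nat) (Y : 'I_n -> T -> R) (X : 'I_m -> T -> R) : Prop :=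
  forall (phi1 : 'rV[R]_m -> R) (phi2 : 'rV[R]_n -> R),
    phi1 \in @ClLip R m -> phi2 \in @ClLip R n ->
    let U := at_vector phi1 X in
    let V := at_vector phi2 Y in
    (forall w, 0 <= U w) ->
    (0 <= E V)%E ->
    (E (fun w => `|U w * V w|)%R < +oo)%E ->
    (E (fun w => `|U w|)%R < +oo)%E ->
    (E (fun w => `|V w|)%R < +oo)%E ->
    (coord_nondecreasing phi1 /\ coord_nondecreasing phi2) \/
    (coord_nonincreasing phi1 /\ coord_nonincreasing phi2) ->
    (E (fun w => U w * V w)%R <= E U * E V)%E.

Definition partial_sum (R : realType) (T : Type) (X : nat -> T -> R) (k : nat) :
    T -> R :=
  fun w => \sum_(1 <= i < k.+1) X i w.

(* The maximum of the partial sums of index 1, ..., n, for 1 <= n; the base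
   value of the iterated maximum is the first partial sum. *)
Definition max_partial_sum (R : realType) (T : Type) (X : nat -> T -> R)
    (n : nat) : T -> R :=
  fun w => \big[Num.max/partial_sum X 1 w]_(1 <= k < n.+1) partial_sum X k w.

(* Main.v *)
Require Import Defs.
From HB Require Import structures.
From mathcomp Require Import all_boot all_order all_algebra.
From mathcomp Require Import all_classical all_reals all_analysis.
From mathcomp Require Import ring lra.

(** The maximum of the partial sums is computed backwards. Let T_k be the
    maximum of the sums X_k + ... + X_j over k <= j <= n; then
    T_k = X_k + U_k with U_k = max(0, T_(k+1)), and T_1 is the maximum to be
    bounded. Since U_k ^+ 2 <= T_(k+1) ^+ 2, it suffices to prove
      E[(X_k + U_k) ^+ 2] <= E[X_k ^+ 2] + E[U_k ^+ 2]
    ([neg_dependent_sqr_add]) and to iterate downwards from k = n.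

    By sub-additivity this reduces to E[U_k X_k] <= 0
    ([neg_dependent_mul_le0]). The variable U_k is nonnegative and is a
    nondecreasing Lipschitz function of X_(k+1), ..., X_n ([posmax]), so
    negative dependence can be applied to it, but only against a function of
    X_k of nonnegative expectation. Centering provides one: with c = E[X_k],
    which is finite and nonpositive, V = X_k - c satisfies E[V] = 0 and
    X_k <= V, so that E[U_k X_k] <= E[U_k V] <= E[U_k] E[V] = 0.

    The integrability conditions of negative dependence follow from finiteness
    of the two second moments; when one of those is +oo, so is the right-hand
    side, because the other one is nonnegative. *)

Set Implicit Arguments.
Unset Strict Implicit.
Unset Printing Implicit Defensive.

Import Order.TTheory GRing.Theory Num.Theory.
Import numFieldNormedType.Exports.

Local Open Scope classical_set_scope.
Local Open Scope ring_scope.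


(** * Locally Lipschitz functions of polynomial growth *)

Section PolynomiallyLipschitz.
Variable R : realType.

Lemma enorm_ge0 n (x : 'rV[R]_n) : 0 <= enorm x.
Proof. exact: sqrtr_ge0. Qed.

Lemma coord_le_enorm n (x : 'rV[R]_n) i : `|x 0 i| <= enorm x.
Proof.
rewrite -sqrtr_sqr ler_wsqrtr// (bigD1 i)//= lerDl.
by apply: sumr_ge0 => j _; exact: sqr_ge0.
Qed.

(** The criterion is stated with the l1 norm because that bound adds up along
    the recursion that defines [posmax]; it costs a factor n against the
    Euclidean norm. *)
Lemma l1_lipschitz_ClLip n (phi : 'rV[R]_n -> R) :
  (forall x y, `|phi x - phi y| <= \sum_i `|x 0 i - y 0 i|) ->
  phi \in @ClLip R n.
Proof.
move=> phi_lip; rewrite inE; exists n.+1%:R => //; exists 0%N => x y.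
apply: le_trans (phi_lip x y) _.
apply: (@le_trans _ _ (\sum_(i < n) enorm (x - y))).
  by apply: ler_sum => i _; have := coord_le_enorm (x - y) i; rewrite !mxE.
rewrite sumr_const card_ord -[enorm _ *+ n]mulr_natl !expr0 -(natr1 n).
have n_ge0 : 0 <= n%:R :> R by [].
by have := mulr_ge0 n_ge0 (enorm_ge0 (x - y)); have := enorm_ge0 (x - y); lra.
Qed.

(** This single non-Lipschitz function makes a space of random variables stable
    under products, hence under every polynomial operation needed below. *)
Lemma mul_coord_ClLip : (fun x : 'rV[R]_2 => x 0 0 * x 0 1) \in @ClLip R 2.
Proof.
rewrite inE; exists 1 => //; exists 1%N => x y; rewrite !expr1 mul1r.
have -> : x 0 0 * x 0 1 - y 0 0 * y 0 1 =
    x 0 0 * (x - y) 0 1 + y 0 1 * (x - y) 0 0 by rewrite !mxE; ring.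
apply: le_trans (ler_normD _ _) _; rewrite !normrM.
apply: (@le_trans _ _ (enorm x * enorm (x - y) + enorm y * enorm (x - y))).
  by apply: lerD; apply: ler_pM => //; exact: coord_le_enorm.
by rewrite -mulrDl ler_wpM2r ?enorm_ge0// -addrA lerDr.
Qed.

End PolynomiallyLipschitz.

(** * The positive part of the maximum of prefix sums *)

Section PositiveMax.
Variable R : realType.

(** The maximum of 0 and of all the prefix sums f 0 + ... + f k, in the Horner
    form max(0, f 0 + max(0, f 1 + ...)), from which the recursion
    T_k = X_k + max(0, T_(k+1)) can be read off. *)
Fixpoint posmax m : ('I_m -> R) -> R :=
  if m is m'.+1 then
    fun f => Num.max 0 (f ord0 + posmax (fun i => f (lift ord0 i)))
  else fun=> 0.

Lemma posmax_ge0 m (f : 'I_m -> R) : 0 <= posmax f.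
Proof. by case: m f => [|m] f //=; rewrite le_max lexx. Qed.

Lemma posmax_mono m (f g : 'I_m -> R) :
  (forall i, f i <= g i) -> posmax f <= posmax g.
Proof.
elim: m f g => [|m IHm] f g fg //=.
by rewrite ge_max !le_max lexx/= lerD ?orbT// IHm.
Qed.

Lemma posmax_lipschitz m (f g : 'I_m -> R) :
  `|posmax f - posmax g| <= \sum_i `|f i - g i|.
Proof.
elim: m f g => [|m IHm] f g /=; first by rewrite subrr normr0 big_ord0.
have max0_lip (x y : R) : `|Num.max 0 x - Num.max 0 y| <= `|x - y|.
  have := ler_norm (x - y); have := ler_norm (y - x); rewrite (distrC y).
  rewrite ler_norml /Num.max.
  by do 2 case: ltP => ? /=; move=> *; apply/andP; split; lra.
apply: le_trans (max0_lip _ _) _; rewrite opprD addrACA big_ord_recl.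
by apply: le_trans (ler_normD _ _) _; rewrite lerD2l.
Qed.

Definition posmax_row m (x : 'rV[R]_m) : R := posmax (fun i => x 0 i).

Lemma posmax_row_ClLip m : @posmax_row m \in @ClLip R m.
Proof. by apply: l1_lipschitz_ClLip => x y; exact: posmax_lipschitz. Qed.

Lemma posmax_row_mono m : coord_nondecreasing (@posmax_row m).
Proof. by move=> x y xy; exact: posmax_mono. Qed.

Lemma at_vector_posmax_row (T : Type) m (Y : 'I_m -> T -> R) :
  at_vector (@posmax_row m) Y = fun w => posmax (fun i => Y i w).
Proof.
apply/funext => w; rewrite /at_vector /posmax_row.
by congr posmax; apply/funext => i; rewrite mxE.
Qed.

(** The base value [y] is kept independent of the offset [z]: peeling off the
    first term moves the offset to z + g 0 but leaves the base value of the
    iterated maximum unchanged. *)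
Lemma bigmax_prefix_sums m (g : nat -> R) y z :
  Num.max z (\big[Num.max/y]_(0 <= k < m) (z + \sum_(0 <= i < k.+1) g i)) =
  Num.max y (z + posmax (fun i : 'I_m => g i)).
Proof.
elim: m g z => [|m IHm] g z; first by rewrite big_geq//= addr0 maxC.
rewrite big_nat_recl// big_nat1.
under eq_bigr do rewrite big_nat_recl// addrA.
rewrite (IHm (fun i => g i.+1)) /= maxCA.
by rewrite addr_maxr addr0 addrA.
Qed.

End PositiveMax.

Lemma max_partial_sumE (R : realType) (T : Type) (X : nat -> T -> R) m w :
  max_partial_sum X m.+1 w = X 1%N w + posmax (fun i : 'I_m => X (1 + i.+1)%N w).
Proof.
rewrite /max_partial_sum big_ltn// /partial_sum big_nat1 !big_add1/=.
under eq_bigr do rewrite big_ltn// !big_add1/=.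
rewrite (bigmax_prefix_sums m (fun i => X i.+2 w)); apply/max_idPr.
by rewrite lerDl posmax_ge0.
Qed.

(** * Second moments and negative dependence *)

Section RandomVariables.
Variables (R : realType) (T : Type) (H : set (T -> R)).
Hypothesis H_space : is_rv_space H.

Lemma rv_lin (a : R) X Y : X \in H -> Y \in H -> (fun w => a * X w + Y w) \in H.
Proof. by move=> XH YH; have [_ /(_ a X Y XH YH)] := rv_space_linear H_space. Qed.

(** A constant is a locally Lipschitz function of zero variables. *)
Lemma rv_cst c : cst c \in H.
Proof.
apply: (rv_space_comp H_space (phi := fun _ : 'rV[R]_0 => c)
  (X := fun _ _ => 0)) => [|[]//].
by apply: l1_lipschitz_ClLip => x y; rewrite subrr normr0 big_ord0.
Qed.

Lemma rv_add X Y : X \in H -> Y \in H -> (X \+ Y) \in H.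
Proof.
move=> XH YH; have := rv_lin 1 XH YH.
by congr (_ \in H); apply/funext => w; rewrite mul1r.
Qed.

Lemma rv_scale a X : X \in H -> (fun w => a * X w) \in H.
Proof.
move=> XH; have := rv_lin a XH (rv_cst 0).
by congr (_ \in H); apply/funext => w; rewrite addr0.
Qed.

Lemma rv_mul X Y : X \in H -> Y \in H -> (fun w => X w * Y w) \in H.
Proof.
move=> XH YH; pose Z (i : 'I_2) := if i == 0 then X else Y.
have := rv_space_comp H_space (X := Z) (mul_coord_ClLip R).
rewrite (_ : at_vector _ _ = fun w => X w * Y w); last first.
  by apply/funext => w; rewrite /at_vector !mxE.
by apply=> i; rewrite /Z; case: ifP.
Qed.

Lemma rv_sqr X : X \in H -> (fun w => X w ^+ 2) \in H.
Proof. by move=> XH; exact: rv_mul. Qed.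

Lemma rv_norm X : X \in H -> (fun w => `|X w|) \in H.
Proof.
move=> XH; have := rv_space_comp H_space (X := fun _ : 'I_1 => X)
  (phi := fun x => `|x 0 0|).
rewrite (_ : at_vector _ _ = fun w => `|X w|); last first.
  by apply/funext => w; rewrite /at_vector !mxE.
apply=> //; apply: l1_lipschitz_ClLip => x y.
by rewrite big_ord1; exact: ler_dist_dist.
Qed.

Lemma rv_posmax m (Y : 'I_m -> T -> R) : (forall i, Y i \in H) ->
  (fun w => posmax (fun i => Y i w)) \in H.
Proof.
move=> YH; rewrite -at_vector_posmax_row.
exact: rv_space_comp (posmax_row_ClLip _ _) YH.
Qed.

Variable E : (T -> R) -> \bar R.
Hypothesis E_sublin : is_sublinear_expectation H E.

(** Below +oo, neither of the two indeterminate sums can occur. *)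
Lemma sublin_subadd_lty X Y : X \in H -> Y \in H ->
  (E X < +oo -> E Y < +oo -> E (X \+ Y)%R <= E X + E Y)%E.
Proof.
move=> XH YH EX EY; apply: (sublin_subadd E_sublin) => //.
by move: EX EY; case: (E X) => [r||]; case: (E Y) => [s||].
Qed.

Lemma sublin_ge0 X : X \in H -> (forall w, 0 <= X w) -> (0 <= E X)%E.
Proof.
move=> XH X_ge0; apply: (@le_trans _ _ (E (cst 0))).
  by rewrite (sublin_cst E_sublin).
by apply: (sublin_mono E_sublin) => //; exact: rv_cst.
Qed.

Lemma sublin_le_lty X Y : X \in H -> Y \in H -> (forall w, X w <= Y w) ->
  (E Y < +oo -> E X < +oo)%E.
Proof. by move=> XH YH XY; apply: le_lt_trans; exact: (sublin_mono E_sublin). Qed.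

Lemma sublin_add_lty X Y : X \in H -> Y \in H ->
  (E X < +oo -> E Y < +oo -> E (X \+ Y)%R < +oo)%E.
Proof.
move=> XH YH EX EY; apply: le_lt_trans (sublin_subadd_lty XH YH EX EY) _.
exact: lte_add_pinfty.
Qed.

(** From |xy| <= x^2 + y^2. *)
Lemma sqr_norm_mul_lty X Y : X \in H -> Y \in H ->
  (E (fun w => X w ^+ 2)%R < +oo -> E (fun w => Y w ^+ 2)%R < +oo ->
   E (fun w => `|X w * Y w|)%R < +oo)%E.
Proof.
move=> XH YH EX EY; have XXH := rv_sqr XH; have YYH := rv_sqr YH.
apply: sublin_le_lty (sublin_add_lty XXH YYH EX EY).
- by apply: rv_norm; exact: rv_mul.
- exact: rv_add.
move=> w /=; rewrite normrM -(real_normK (num_real (X w))).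
rewrite -(real_normK (num_real (Y w))).
have := normr_ge0 (X w); have := normr_ge0 (Y w).
move: `|X w| `|Y w| => x y; nra.
Qed.

Lemma sqr_norm_lty X : X \in H ->
  (E (fun w => X w ^+ 2)%R < +oo -> E (fun w => `|X w|)%R < +oo)%E.
Proof.
move=> XH EX; have := sqr_norm_mul_lty XH (rv_cst 1) EX.
have -> : (fun w => cst 1 w ^+ 2) = cst 1 :> (T -> R).
  by apply/funext => w /=; rewrite expr1n.
rewrite (sublin_cst E_sublin) => /(_ (ltry _)).
by congr (E _ < _)%E; apply/funext => w; rewrite mulr1.
Qed.

(** From (x + c)^2 <= 2 x^2 + 2 c^2. *)
Lemma sqr_add_cst_lty X c : X \in H ->
  (E (fun w => X w ^+ 2)%R < +oo -> E (fun w => (X w + c) ^+ 2)%R < +oo)%E.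
Proof.
move=> XH EX; have XXH := rv_sqr XH; have cH := rv_cst (2 * c ^+ 2).
apply: (@sublin_le_lty _ ((fun w => 2 * X w ^+ 2) \+ cst (2 * c ^+ 2))).
- by apply: rv_sqr; apply: rv_add => //; exact: rv_cst.
- by apply: rv_add => //; exact: rv_scale.
- by move=> w /=; have := sqr_ge0 (X w - c); nra.
apply: sublin_add_lty => //; first exact: rv_scale.
- rewrite (sublin_homo E_sublin)//; apply: lte_mul_pinfty => //.
- by rewrite (sublin_cst E_sublin) ltry.
Qed.

(** Otherwise 0 = E[X - X] <= E[X] + E[-X] would be -oo. *)
Lemma sublin_gtNy X : X \in H ->
  (E (fun w => `|X w|)%R < +oo -> -oo < E X)%E.
Proof.
move=> XH EaX; have NXH := rv_scale (-1) XH.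
have ENX : (E (fun w => -1 * X w)%R < +oo)%E.
  apply: sublin_le_lty EaX => //; first exact: rv_norm.
  by move=> w; rewrite mulN1r -normrN ler_norm.
rewrite ltNge leeNy_eq; apply/negP => /eqP EX.
have := sublin_subadd_lty XH NXH; rewrite EX => /(_ isT ENX).
have -> : X \+ (fun w => -1 * X w) = cst 0.
  by apply/funext => w /=; rewrite mulN1r subrr.
by rewrite (sublin_cst E_sublin) addNye.
Qed.

(** Sub-additivity applied to [c] and again to [- c] gives both inequalities. *)
Lemma sublin_addr_cst X c : X \in H -> E X \is a fin_num ->
  (E (fun w => X w + c)%R = E X + c%:E)%E.
Proof.
have le X' c' : X' \in H -> (E X' < +oo -> 
    E (fun w => X' w + c')%R <= E X' + c'%:E)%E.
  move=> XH EX; rewrite -(sublin_cst E_sublin c').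
  apply: (sublin_subadd_lty XH (rv_cst c')) => //.
  by rewrite (sublin_cst E_sublin) ltry.
move=> XH EX; have EX_lty : (E X < +oo)%E by rewrite ltey_eq EX.
apply/eqP; rewrite eq_le le//=.
have XcH : (fun w => X w + c) \in H by apply: rv_add => //; exact: rv_cst.
have := @le _ (- c) XcH; rewrite EFinN leeBrDr//.
have -> : (fun w => X w + c + - c) = X by apply/funext => w; rewrite addrK.
apply; apply: le_lt_trans (le _ _ XH EX_lty) _.
by rewrite lte_add_pinfty ?ltry.
Qed.

(** Negative dependence only concerns functions of [X] with nonnegative
    expectation, so it is applied to the centered variable X - E[X], which has
    expectation 0 and dominates [X] because E[X] <= 0. *)
Lemma neg_dependent_mul_le0 m (X : T -> R) (Y : 'I_m -> T -> R)
    (phi : 'rV[R]_m -> R) :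
  X \in H -> (forall i, Y i \in H) ->
  neg_dependent E (fun _ : 'I_1 => X) Y ->
  (E X <= 0)%E -> (E (fun w => X w ^+ 2)%R < +oo)%E ->
  phi \in @ClLip R m -> coord_nondecreasing phi ->
  (forall w, 0 <= at_vector phi Y w) ->
  (E (fun w => at_vector phi Y w ^+ 2)%R < +oo)%E ->
  (E (fun w => at_vector phi Y w * X w)%R <= 0)%E.
Proof.
set U := at_vector phi Y => XH YH XY EX_le0 EXX phi_ClLip phi_mono U_ge0 EUU.
have UH : U \in H by exact: rv_space_comp.
have EX_fin : E X \is a fin_num.
  rewrite fin_numElt (le_lt_trans EX_le0)// andbT.
  by apply: sublin_gtNy => //; exact: sqr_norm_lty.
pose c := fine (E X); pose V w := X w + - c.
have c_le0 : c <= 0 by rewrite -lee_fin fineK.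
have VH : V \in H by apply: rv_add => //; exact: rv_cst.
have EV0 : E V = 0%E by rewrite sublin_addr_cst// EFinN fineK// subee.
have EVV : (E (fun w => V w ^+ 2)%R < +oo)%E by exact: sqr_add_cst_lty.
apply: (@le_trans _ _ (E (fun w => U w * V w))).
  apply: (sublin_mono E_sublin); rewrite ?rv_mul// => w.
  by rewrite ler_wpM2l// lerDl oppr_ge0.
pose psi (x : 'rV[R]_1) := x 0 0 + - c.
have psiV : at_vector psi (fun=> X) = V.
  by apply/funext => w; rewrite /at_vector /psi mxE.
have := XY phi psi phi_ClLip; rewrite /= psiV EV0 mule0; apply => //.
- apply: l1_lipschitz_ClLip => x y; rewrite big_ord1 /psi.
  by rewrite opprD addrACA subrr addr0.
- exact: sqr_norm_mul_lty.
- exact: sqr_norm_lty.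
- exact: sqr_norm_lty.
- by left; split=> // x y xy; rewrite /psi lerD2r.
Qed.

(** The cross term of the square contributes nothing, by
    [neg_dependent_mul_le0] when both second moments are finite;
    otherwise the right-hand side is +oo. *)
Lemma neg_dependent_sqr_add m (X : T -> R) (Y : 'I_m -> T -> R)
    (phi : 'rV[R]_m -> R) :
  X \in H -> (forall i, Y i \in H) ->
  neg_dependent E (fun _ : 'I_1 => X) Y -> (E X <= 0)%E ->
  phi \in @ClLip R m -> coord_nondecreasing phi ->
  (forall w, 0 <= at_vector phi Y w) ->
  (E (fun w => (X w + at_vector phi Y w) ^+ 2)%R <=
   E (fun w => X w ^+ 2)%R + E (fun w => at_vector phi Y w ^+ 2)%R)%E.
Proof.
move=> XH YH XY EX_le0 phi_ClLip phi_mono U_ge0.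
have := neg_dependent_mul_le0 XH YH XY EX_le0 _ phi_ClLip phi_mono U_ge0.
have UH : at_vector phi Y \in H by exact: rv_space_comp.
move: (at_vector phi Y) UH U_ge0 => U UH U_ge0 EUX.
have XXH := rv_sqr XH; have UUH := rv_sqr UH; have UXH := rv_mul UH XH.
have EXX0 : (0 <= E (fun w => X w ^+ 2)%R)%E.
  by apply: sublin_ge0 => // w; exact: sqr_ge0.
have EUU0 : (0 <= E (fun w => U w ^+ 2)%R)%E.
  by apply: sublin_ge0 => // w; exact: sqr_ge0.
have [EXX|EXX] := ltP (E (fun w => X w ^+ 2)) +oo%E; last first.
  move: EXX; rewrite leye_eq => /eqP ->.
  by rewrite addye ?leey// gt_eqF// (lt_le_trans _ EUU0).
have [EUU|EUU] := ltP (E (fun w => U w ^+ 2)) +oo%E; last first.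
  move: EUU; rewrite leye_eq => /eqP ->.
  by rewrite addey ?leey// gt_eqF// (lt_le_trans _ EXX0).
have {}EUX := EUX EXX EUU.
have UX2H := rv_scale 2 UXH.
have EUX2 : (E (fun w => 2 * (U w * X w))%R <= 0)%E.
  by rewrite (sublin_homo E_sublin)// mule_ge0_le0.
have EUX2_lty := le_lt_trans EUX2 (ltry 0).
have -> : (fun w => (X w + U w) ^+ 2) =
    ((fun w => X w ^+ 2) \+ (fun w => U w ^+ 2)) \+ (fun w => 2 * (U w * X w)).
  by apply/funext => w /=; ring.
apply: le_trans (sublin_subadd_lty (rv_add XXH UUH) UX2H _ EUX2_lty) _.
  exact: sublin_add_lty.
rewrite -[leRHS]adde0; apply: leeD => //; exact: sublin_subadd_lty.
Qed.

End RandomVariables.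

Theorem corollary1p7 (R : realType) (d : measure_display) (Omega : measurableType d)
    (H : set (Omega -> R)) (E : (Omega -> R) -> \bar R)
    (H_space : is_rv_space H) (E_sublin : is_sublinear_expectation H E)
    (n : nat) (n_gt0 : (1 <= n)%N) (X : nat -> Omega -> R)
    (X_in : forall k : nat, (1 <= k <= n)%N -> X k \in H)
    (X_le0 : forall k : nat, (1 <= k <= n)%N -> (E (X k) <= 0)%E)
    (X_nd : forall k : nat, (1 <= k < n)%N ->
       neg_dependent E (fun _ : 'I_1 => X k)
                       (fun i : 'I_(n - k) => X (k + i.+1)%N)) :
  (E (fun w => max_partial_sum X n w ^+ 2)%R
     <= \sum_(1 <= k < n.+1) E (fun w => X k w ^+ 2)%R)%E.
Proof.
(* Here X k + posmax (X k.+1, ..., X n) is the maximum T_k of the sums that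
   start at index k, and the induction runs on the number m of later indices. *)
have tail k m : (1 <= k)%N -> (k + m = n)%N ->
  (E (fun w => (X k w + posmax (fun i : 'I_m => X (k + i.+1)%N w)) ^+ 2)%R
     <= \sum_(k <= j < n.+1) E (fun w => X j w ^+ 2)%R)%E.
  elim: m k => [|m IHm] k k_gt0 kmn.
    rewrite -kmn addn0 big_nat1 /=.
    by under eq_fun do rewrite addr0.
  have k_lt_n : (k < n)%N by rewrite -kmn -addSnnS leq_addr.
  have k_in : (1 <= k <= n)%N by rewrite k_gt0 ltnW.
  have Y_in (i : 'I_m.+1) : X (k + i.+1)%N \in H.
    by apply: X_in; rewrite addnS/= -kmn -addnS leq_add2l.
  have := X_nd k; rewrite k_gt0 k_lt_n => /(_ isT).
  rewrite (_ : (n - k)%N = m.+1); last by rewrite -kmn addKn.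
  move=> X_ndk.
  have := neg_dependent_sqr_add H_space E_sublin (X_in _ k_in) Y_in X_ndk
    (X_le0 _ k_in) (@posmax_row_ClLip R _) (@posmax_row_mono R _).
  rewrite at_vector_posmax_row => /(_ (fun w => posmax_ge0 _)) sqr_add.
  rewrite big_ltn ?ltnS 1?ltnW//; apply: le_trans sqr_add _.
  apply: leeD => //; apply: le_trans (IHm k.+1 _ _); rewrite ?addSnnS//.
  have max_in := rv_posmax H_space Y_in.
  have tail_in : (fun w => X k.+1 w +
      posmax (fun i : 'I_m => X (k.+1 + i.+1)%N w)) \in H.
    apply: (rv_add H_space); first by apply: X_in; rewrite k_lt_n.
    apply: (rv_posmax H_space) => i.
    by rewrite addSnnS; exact: (Y_in (lift ord0 i)).
  (* Remains max(0, t)^2 <= t^2, with t the maximum starting at k.+1. *)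
  apply: (sublin_mono E_sublin); try exact: (rv_sqr H_space).
  move=> w /=; rewrite addn1.
  under eq_fun do rewrite -addSnnS.
  rewrite /Num.max; case: ifP => // _.
  by rewrite expr0n sqr_ge0.
have := tail 1%N n.-1 isT; rewrite add1n prednK// => /(_ erefl).
by congr (E _ <= _)%E; apply/funext => w; rewrite -max_partial_sumE prednK.
Qed.
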